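(* Let $A\in\mathbb{R}^{n\times n}$ be nilpotent with nilpotency index $q\le n$ (i.e. $A^q=0$ and $A^{q-1}\neq 0$), let $B_0\in\mathbb{R}^{n\times m}$ be such that $(A,B_0)$ is controllable, let $\tau_M>0$, let $\tau_0\in[0,\tau_M]$ be a constant (unknown to the controller), and let $h\ge\tau_M$. Let $S$ be an admissible weighting function (for this $h$), and let $W_{\mathrm c}$, $g$ and $K$ be as defined in the context. Consider the system $$\dot x(t)=Ax(t)+B_0u(t),\qquad y(t)=x(t-\tau_0),\qquad t\ge 0,$$ (with $y(s)=0$ for $s\le 0$) under the time-varying controller $$u(t)=-K(t)\,S(t)\,g(t)\,y(t-h),\qquad t\ge 0 .$$ Then, for every initial state $x(0)\in\mathbb{R}^n$, the solution of the closed-loop system satisfies $x(t)=0$ and $u(t)=0$ for all $t\ge 3qh$.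
   Context: Admissible weighting function: a function $S:\mathbb{R}_{\ge0}\to\mathbb{R}$ such that (1) $S$ is continuously differentiable and $3h$-periodic; (2) $S(t)\ge0$ for all $t\in[2h,3h]$ and there is $h_\ast\in(2h,3h)$ with $S(h_\ast)>0$; (3) $S(2h)=S(3h)=0$ and $S'(2h)=S'(3h)=0$. The switching function $g$ is defined, for $l\in\mathbb{Z}_{\ge0}$, by $g(t)=0$ for $t\in[3lh,(3l+2)h]$ and $g(t)=1$ for $t\in((3l+2)h,(3l+3)h)$. The weighted Gramian is $$W_{\mathrm c}=\int_{2h}^{3h}e^{-As}B_0S(s)B_0^{\mathrm T}e^{-A^{\mathrm T}s}\,ds,$$ which is invertible because $(A,B_0)$ is controllable. The gain is, with $l=\lfloor t/(3h)\rfloor$, $$K(t)=B_0^{\mathrm T}e^{-A^{\mathrm T}(t-3lh)}W_{\mathrm c}^{-1}e^{-A(t-3lh-h)} .$$ *)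

(* Defs.v *)
From HB Require Import structures.
From mathcomp Require Import all_boot all_order all_algebra.
From mathcomp Require Import all_classical all_reals all_analysis.

Set Implicit Arguments.
Unset Strict Implicit.
Unset Printing Implicit Defensive.

Import Order.TTheory GRing.Theory Num.Theory.
Import numFieldNormedType.Exports.

Local Open Scope classical_set_scope.
Local Open Scope ring_scope.

Definition expmx (R : realType) (n : nat) (M : 'M[R]_n) : 'M[R]_n :=
  limn (series (fun k : nat => (k`!%:R)^-1 *: M ^+ k)).

(* Controllability in the state-transfer sense: any state can be steered to
   any other one in some finite time T > 0 by an input continuous on [0, T]. *)
Definition controllable (R : realType) (n m : nat)
    (A : 'M[R]_n) (B : 'M[R]_(n, m)) : Prop :=
  forall x0 x1 : 'cV[R]_n,
  exists (T : R) (u : R -> 'cV[R]_m) (x : R -> 'cV[R]_n),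
    [/\ 0 < T,
        {within `[0, T], continuous u},
        derivable_oo_LRcontinuous x 0 T,
        forall t : R, 0 < t < T -> is_derive t (1 : R) x (A *m x t + B *m u t)
      & x 0 = x0 /\ x T = x1].

(* Weighting functions live on [0, +oo[; their values on negative reals are
   junk.  The first three clauses say that S is C^1 on [0, +oo[, one-sidedly
   at 0: the existence of the limit of S' at 0+, together with the continuity
   of S at 0, amounts to the existence and continuity of the right derivative
   there. *)
Definition admissible_weight (R : realType) (h : R) (S : R -> R) : Prop :=
  [/\ [/\ derivable_oy_Rcontinuous S 0,
          {in `]0, +oo[, continuous (derive1 S)},
          cvg (derive1 S t @[t --> 0^'+])
        & forall t : R, 0 <= t -> S (t + 3 * h) = S t],
      forall t : R, 2 * h <= t <= 3 * h -> 0 <= S t,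
      exists2 hs, 2 * h < hs < 3 * h & 0 < S hs,
      S (2 * h) = 0 /\ S (3 * h) = 0
    & derive1 S (2 * h) = 0 /\ derive1 S (3 * h) = 0].

Definition switch (R : realType) (h : R) : R -> R :=
  \1_(\bigcup_(l : nat) `](3 * l%:R + 2) * h, (3 * l%:R + 3) * h[%classic).

Definition Gramian (R : realType) (n m : nat)
    (A : 'M[R]_n) (B0 : 'M[R]_(n, m)) (h : R) (S : R -> R) : 'M[R]_n :=
  \matrix_(i, j) \int[lebesgue_measure]_(s in `[2 * h, 3 * h])
    (S s *: (expmx (- (s *: A)) *m B0 *m B0^T *m expmx (- (s *: A^T)))) i j.

Definition gain (R : realType) (n m : nat)
    (A : 'M[R]_n) (B0 : 'M[R]_(n, m)) (h : R) (S : R -> R) (t : R)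
    : 'M[R]_(m, n) :=
  let l : R := (Num.floor (t / (3 * h)))%:~R in
  B0^T *m expmx (- ((t - 3 * l * h) *: A^T)) *m invmx (Gramian A B0 h S)
    *m expmx (- ((t - 3 * l * h - h) *: A)).

(* y(t) = x(t - tau0), with y = 0 up to time 0.  For 0 < t < tau0 this reads
   the values of x on ]-tau0, 0[, i.e. an arbitrary prehistory. *)
Definition delayed_output (R : realType) (n : nat) (tau0 : R)
    (x : R -> 'cV[R]_n) (t : R) : 'cV[R]_n :=
  if t <= 0 then 0 else x (t - tau0).

(* The input u is continuous along any such x, so solutions are classical:
   continuous at 0 from the right and differentiable at every t > 0 (hence
   also right-differentiable at 0). *)
Definition closed_loop_solution (R : realType) (n m : nat)
    (A : 'M[R]_n) (B0 : 'M[R]_(n, m)) (tau0 h : R) (S : R -> R)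
    (x0 : 'cV[R]_n) (x : R -> 'cV[R]_n) (u : R -> 'cV[R]_m) : Prop :=
  [/\ x 0 = x0,
      x t @[t --> 0^'+] --> x 0,
      forall t : R, 0 < t -> is_derive t (1 : R) x (A *m x t + B0 *m u t)
    & forall t : R, 0 <= t ->
        u t = - ((S t * switch h t) *:
                   (gain A B0 h S t *m delayed_output tau0 x (t - h)))].

(* Main.v *)
(** On the period [3lh, 3(l+1)h] with x(3lh) = z, the input vanishes up to
(3l+2)h, so the delayed output read afterwards still belongs to the free
motion of the same period, because tau0 <= h.  The input is then
- S(s) B0^T e^{-A^T s} W^-1 e^{-A tau0} z with s = t - 3lh, and the variation of
constants formula turns its effect into W W^-1 e^{-A tau0} z.  Hence
x(3(l+1)h) = e^{3hA} (I - e^{-A tau0}) z, and this matrix is A times a matrix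
commuting with A, so its q-th power vanishes.

Since A is nilpotent, e^{At} is a polynomial in t.  If v W = 0 then
v e^{-As} B0 vanishes near a point where S > 0; differentiating there repeatedly
shows that it vanishes for all s, and controllability yields v = 0. *)

Require Import Defs.
From HB Require Import structures.
From mathcomp Require Import all_boot all_order all_algebra.
From mathcomp Require Import all_classical all_reals all_analysis.
From mathcomp Require Import ring lra.

Set Implicit Arguments.
Unset Strict Implicit.
Unset Printing Implicit Defensive.

Import Order.TTheory GRing.Theory Num.Theory.
Import numFieldNormedType.Exports.

Local Open Scope classical_set_scope.
Local Open Scope ring_scope.

(** * Derivatives and continuity of matrix-valued functions *)

Lemma is_derive_mxP (R : realType) (m n : nat) (M : R -> 'M[R]_(m, n)) (t : R)
    (dM : 'M[R]_(m, n)) :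
  is_derive t (1 : R) M dM <->
  forall i j, is_derive t (1 : R) (fun s => M s i j) (dM i j).
Proof.
split=> [[dfM <-] i j|dfM].
  by rewrite derive_mx// mxE; apply/derivableP; exact: (derivable_mxP _ _ _).1.
have derM : derivable M t 1.
  by apply/derivable_mxP => i j; exact: ex_derive.
apply: DeriveDef => //; rewrite derive_mx//; apply/matrixP => i j.
by rewrite mxE derive_val.
Qed.

Lemma is_derive_mulmx (R : realType) (m n p : nat)
    (M : R -> 'M[R]_(m, n)) (N : R -> 'M[R]_(n, p)) (t : R) dM dN :
  is_derive t (1 : R) M dM -> is_derive t (1 : R) N dN ->
  is_derive t (1 : R) (fun s => M s *m N s) (dM *m N t + M t *m dN).
Proof.
move=> /is_derive_mxP dfM /is_derive_mxP dfN; apply/is_derive_mxP => i j.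
have -> : (fun s => (M s *m N s) i j) =
    \sum_k ((fun s => M s i k) * (fun s => N s k j)).
  by apply/funext => s; rewrite mxE fct_sumE.
rewrite !mxE -big_split /=; apply: is_derive_eq.
by apply: eq_bigr => k _; rewrite addrC; congr (_ + _); rewrite /GRing.scale/= mulrC.
Qed.

Lemma is_derive_mulmxl (R : realType) (m n p : nat)
    (M : 'M[R]_(m, n)) (N : R -> 'M[R]_(n, p)) (t : R) dN :
  is_derive t (1 : R) N dN -> is_derive t (1 : R) (fun s => M *m N s) (M *m dN).
Proof.
move=> dfN; have := is_derive_mulmx (is_derive_cst M t 1) dfN.
by rewrite mul0mx add0r.
Qed.

Lemma is_derive_mulmxr (R : realType) (m n p : nat)
    (M : R -> 'M[R]_(m, n)) (N : 'M[R]_(n, p)) (t : R) dM :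
  is_derive t (1 : R) M dM -> is_derive t (1 : R) (fun s => M s *m N) (dM *m N).
Proof.
move=> dfM; have := is_derive_mulmx dfM (is_derive_cst N t 1).
by rewrite mulmx0 addr0.
Qed.

Lemma is_derive_translate (R : realType) (V : normedModType R) (f : R -> V)
    (a t : R) (df : V) :
  is_derive (t + a) (1 : R) f df -> is_derive t (1 : R) (fun s => f (s + a)) df.
Proof.
have -> : (fun s => f (s + a)) = f \o shift a by [].
have eq_slope : (fun h : R => h^-1 *: ((f \o shift a \o shift t) (h *: 1) - f (t + a)))
   = (fun h : R => h^-1 *: ((f \o shift (t + a)) (h *: 1) - f (t + a))).
  by apply/funext => h /=; rewrite addrA.
by case=> dfa dfE; split; rewrite /derivable /derive eq_slope.
Qed.

Lemma within_continuous_coord (R : realType) (T : topologicalType) (D : set T)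
    (m n : nat) (M : T -> 'M[R]_(m, n)) :
  {within D, continuous M} -> forall i j, {within D, continuous (fun t => M t i j)}.
Proof.
move=> cM i j t; exact: (@cvg_comp _ _ _ M (fun N : 'M[R]_(m, n) => N i j) _ _ _ (cM t)
  (@coord_continuous _ _ _ i j (M t))).
Qed.

Lemma is_derive_coord_continuous (R : realType) (m n : nat) (D : set R)
    (M dM : R -> 'M[R]_(m, n)) : (forall t, is_derive t (1 : R) M (dM t)) ->
  forall i j, {within D, continuous (fun t => M t i j)}.
Proof.
move=> dM_ i j; apply: continuous_subspaceT => t.
apply/differentiable_continuous/derivable1_diffP.
by have /is_derive_mxP/(_ i j)/@ex_derive := dM_ t.
Qed.

Lemma within_continuous_mulmx (R : realType) (T : topologicalType) (D : set T)
    (m n p : nat) (M : T -> 'M[R]_(m, n)) (N : T -> 'M[R]_(n, p)) :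
  (forall i k, {within D, continuous (fun t => M t i k)}) ->
  (forall k j, {within D, continuous (fun t => N t k j)}) ->
  forall i j, {within D, continuous (fun t => (M t *m N t) i j)}.
Proof.
move=> cM cN i j.
have -> : (fun s => (M s *m N s) i j) =
    (fun s => \sum_k (M s i k * N s k j)).
  by apply/funext => s; rewrite mxE.
move=> t; apply: (@continuous_big _ _ +%R) => //=.
- exact: add_continuous.
- by move=> k _; move=> s; apply: continuousM; [exact: cM|exact: cN].
Qed.

(** Entrywise mean value theorem. It replaces uniqueness theorems for linear differential equations:
    each identity between flows below comes from exhibiting a quantity with zero derivative.
    Continuity on the closed interval is a separate hypothesis because the derivative may be known
    only in the interior. *)
Lemma is_derive0_eq (R : realType) (m n : nat) (a b : R) (M : R -> 'M[R]_(m, n)) :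
  a <= b -> (forall i j, {within `[a, b], continuous (fun t => M t i j)}) ->
  {in `]a, b[, forall t, is_derive t (1 : R) M 0} -> M b = M a.
Proof.
move=> ab cM dM; apply/matrixP => i j; apply/eqP; rewrite -subr_eq0.
have [|c _ ->] := @MVT_segment _ (fun t => M t i j) (fun=> 0) a b ab _ (cM i j).
  by move=> t /dM /is_derive_mxP /(_ i j); rewrite mxE.
by rewrite mul0r.
Qed.

(** * The exponential of a nilpotent matrix *)

Lemma exprZmx (R : realType) (n : nat) (a : R) (M : 'M[R]_n) (k : nat) :
  (a *: M) ^+ k = a ^+ k *: M ^+ k.
Proof.
elim: k => [|k ih]; first by rewrite !expr0 scale1r.
by rewrite !exprS ih -!mulmxE -scalemxAl -scalemxAr scalerA.
Qed.

(** The partial sums are stationary from rank [q] on, so the limit defining [expmx] is a finite sum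
    and no convergence argument arises. *)
Lemma nilpotent_expmxE (R : realType) (n q : nat) (M : 'M[R]_n) :
  M ^+ q = 0 -> expmx M = \sum_(k < q) (k`!%:R)^-1 *: M ^+ k.
Proof.
move=> Mq; apply: lim_near_cst; first exact: norm_hausdorff.
exists q => // N /= qN; rewrite /series /= (big_cat_nat _ qN)//= big_mkord.
rewrite [X in _ + X]big_nat_cond [X in _ + X]big1 ?addr0// => k /andP[/andP[qk _] _].
by rewrite -(subnK qk) exprD Mq mulr0 scaler0.
Qed.

Section nilpotent_exponential.
Context {R : realType} {n q : nat} {A : 'M[R]_n}.
Hypothesis Aq : A ^+ q = 0.
Let E (t : R) := expmx (t *: A).

Let EE t : E t = \sum_(k < q) (t ^+ k / k`!%:R) *: A ^+ k.
Proof.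
rewrite /E (@nilpotent_expmxE _ _ q); last by rewrite exprZmx Aq scaler0.
by apply: eq_bigr => k _; rewrite exprZmx scalerA mulrC.
Qed.

Lemma nilpotent_expmx_comm t : comm_mx A (expmx (t *: A)).
Proof.
rewrite -/(E t) EE; apply: comm_mx_sum => k _; rewrite /comm_mx -scalemxAr -scalemxAl.
by rewrite mulmxE -exprS -exprSr.
Qed.

Lemma nilpotent_expmx0 : expmx (0 *: A) = 1%:M.
Proof.
(* For [q = 0] the hypothesis reads [1 = 0], which is exactly the equality of the empty sum with the
   identity. *)
rewrite -/(E 0) EE; case: (q) (Aq) => [|q' _]; first by rewrite expr0 big_ord0.
rewrite big_ord_recl big1 ?addr0 => [|i _]; last by rewrite expr0n/= mul0r scale0r.
by rewrite expr0 fact0 divr1 scale1r.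
Qed.

Lemma trmx_nilpotent_expmx t : (expmx (t *: A))^T = expmx (t *: A^T).
Proof.
have trX k : (A ^+ k)^T = (A^T) ^+ k.
  elim: k => [|k ih]; first exact: trmx1.
  by rewrite exprSr exprS -ih -!mulmxE trmx_mul.
rewrite -/(E t) EE (@nilpotent_expmxE _ _ q); last first.
  by rewrite exprZmx -trX Aq trmx0 scaler0.
rewrite raddf_sum /=; apply: eq_bigr => k _.
by rewrite exprZmx scalerA linearZ/= trX mulrC.
Qed.

Lemma is_derive_nilpotent_expmx (t : R) :
  is_derive t (1 : R) (fun s => expmx (s *: A)) (A *m expmx (t *: A)).
Proof.
have -> : (fun s => expmx (s *: A)) = E by [].
rewrite -/(E t); apply/is_derive_mxP => i j.
have -> : (fun s => E s i j) =
    \sum_(k < q) ((id ^+ k) * cst ((A ^+ k) i j / k`!%:R)).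
  apply/funext => s; rewrite EE summxE fct_sumE; apply: eq_bigr => k _.
  by rewrite mxE [RHS]/GRing.mul/= exprfctE mulrAC mulrA.
have dE (k : 'I_q) : is_derive t (1 : R) ((id ^+ k) * cst ((A ^+ k) i j / k`!%:R))
    (k%:R * t ^+ k.-1 * ((A ^+ k) i j / k`!%:R)).
  by apply: is_derive_eq; rewrite scaler0 add0r /GRing.scale/= mulr1 mulrC.
apply: is_derive_eq; rewrite EE mulmx_sumr summxE.
case: (q) (Aq) => [|q' Aq']; first by rewrite !big_ord0.
(* Differentiation kills the constant term on the left, and [A ^+ q = 0] kills the top term on the
   right; the remaining terms agree after a shift of index. *)
rewrite big_ord_recl big_ord_recr/=.
have -> : (A *m (t ^+ q' / q'`!%:R *: A ^+ q')) i j = 0.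
  by rewrite -scalemxAr mulmxE -exprS Aq' scaler0 mxE.
rewrite addr0 !mul0r add0r; apply: eq_bigr => k _.
rewrite -scalemxAr mulmxE -exprS mxE /= add0n.
have k1 : k.+1%:R != 0 :> R by rewrite pnatr_eq0.
have kf : k`!%:R != 0 :> R by rewrite pnatr_eq0 -lt0n fact_gt0.
by rewrite -[bump 0 k]/(k.+1) factS natrM; field; rewrite kf nat1r.
Qed.

(** The integrating factor of the proof. The free parameter [a] serves both the semigroup law, with
    [a = s + t], and the variation of constants. *)
Lemma is_derive_nilpotent_expmxN (a t : R) :
  is_derive t (1 : R) (fun s => expmx ((a - s) *: A)) (- (A *m expmx ((a - t) *: A))).
Proof.
apply/is_derive_mxP => i j.
have /is_derive_mxP/(_ i j) dE := is_derive_nilpotent_expmx (a - t).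
have da : is_derive t (1 : R) (fun s : R => a - s) (-1).
  have -> : (fun s : R => a - s) = cst a - id by [].
  by apply: is_derive_eq; rewrite sub0r.
rewrite mxE -mulrN1.
exact: (@is_derive1_comp _ (fun s => expmx (s *: A) i j) (fun s => a - s) t _ _ dE da).
Qed.

(** The product $e^{(s+t-r)A}e^{rA}$ does not depend on [r]; compare [r = 0] with [r = t]. *)
Lemma nilpotent_expmxD s t :
  expmx ((s + t) *: A) = expmx (s *: A) *m expmx (t *: A).
Proof.
pose F r := expmx ((s + t - r) *: A) *m expmx (r *: A).
have dF r : is_derive r (1 : R) F 0.
  have := is_derive_mulmx (is_derive_nilpotent_expmxN (s + t) r)
    (is_derive_nilpotent_expmx r).
  by rewrite mulNmx mulmxA -nilpotent_expmx_comm addNr.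
have F_eq a b : a <= b -> F a = F b.
  move=> ab; apply/esym/is_derive0_eq => // i j.
  apply: derivable_within_continuous => r _.
  by have /is_derive_mxP/(_ i j)/@ex_derive := dF r.
have -> : expmx ((s + t) *: A) = F 0 by rewrite /F subr0 nilpotent_expmx0 mulmx1.
have <- : F t = expmx (s *: A) *m expmx (t *: A) by rewrite /F addrK.
by have [/F_eq|/ltW/F_eq] := leP 0 t.
Qed.

Lemma nilpotent_expmxN t : expmx (- t *: A) *m expmx (t *: A) = 1%:M.
Proof. by rewrite -nilpotent_expmxD addNr nilpotent_expmx0. Qed.

(** In the polynomial $e^{tA}$ every term but the identity carries a factor [A], and the cofactor is
    again a polynomial in [A]. This factor [A] is what makes the map over one period nilpotent. *)
Lemma nilpotent_expmx_factor t :
  exists2 P, comm_mx A P & 1%:M - expmx (t *: A) = A *m P.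
Proof.
rewrite -/(E t) EE; case: (q) (Aq) => [|q' _].
  rewrite expr0 => n0; exists 0; first exact: comm_mx0.
  by rewrite big_ord0 subr0 mulmx0.
exists (- \sum_(k < q') (t ^+ k.+1 / (k.+1)`!%:R) *: A ^+ k).
  apply: comm_mxN; apply: comm_mx_sum => k _.
  by rewrite /comm_mx -scalemxAr -scalemxAl mulmxE -exprS -exprSr.
rewrite big_ord_recl /= !expr0 fact0 divr1 scale1r opprD addrA subrr add0r.
rewrite mulmxN mulmx_sumr; congr (- _); apply: eq_bigr => k _.
by rewrite -scalemxAr mulmxE -exprS.
Qed.
End nilpotent_exponential.

(** * Primitives of matrix functions and invertibility of the Gramian *)

Lemma mx_primitive (R : realType) (m n : nat) (a b : R) (M : R -> 'M[R]_(m, n)) :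
  a < b -> (forall i j, {within `[a, b], continuous (fun t => M t i j)}) ->
  exists F : R -> 'M[R]_(m, n),
    [/\ F a = 0,
        F b = \matrix_(i, j) \int[lebesgue_measure]_(t in `[a, b]) M t i j,
        forall i j, {within `[a, b], continuous (fun t => F t i j)}
      & {in `]a, b[, forall t, is_derive t (1 : R) F (M t)}].
Proof.
move=> ab cM.
pose I (f : R -> R) t := \int[lebesgue_measure]_(s in `[a, t]) f s.
have iM i j : lebesgue_measure.-integrable `[a, b] (EFin \o (fun t => M t i j)).
  by apply: continuous_compact_integrable => //; exact: segment_compact.
exists (fun t => \matrix_(i, j) I (fun t => M t i j) t); split => //.
- by apply/matrixP => i j; rewrite !mxE /I set_itv1 Rintegral_set1.
- move=> i j.
  have -> : (fun t => (\matrix_(i, j) I (fun t => M t i j) t) i j) = I (fun t => M t i j).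
    by apply/funext => t; rewrite mxE.
  exact: parameterized_integral_continuous (ltW ab) (iM i j).
- move=> t tab; apply/is_derive_mxP => i j.
  have -> : (fun t => (\matrix_(i, j) I (fun t => M t i j) t) i j) = I (fun t => M t i j).
    by apply/funext => s; rewrite mxE.
  have [atb] : a < t /\ t < b by move: tab; rewrite in_itv/= => /andP.
  move=> tb.
  have /(continuous_within_itvP _ ab)[cMt _ _] := cM i j.
  have [dI I'] := continuous_FTC1_closed tb (iM i j) atb (cMt _ tab).
  by apply: DeriveDef; [exact: dI|rewrite -derive1E I'].
Qed.

Lemma mul_rV_tr_ge0 (R : realDomainType) (n : nat) (w : 'rV[R]_n) :
  0 <= (w *m w^T) 0 0.
Proof. by rewrite mxE; apply: sumr_ge0 => k _; rewrite mxE -expr2 sqr_ge0. Qed.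

Lemma mul_rV_tr_eq0 (R : realDomainType) (n : nat) (w : 'rV[R]_n) :
  (w *m w^T) 0 0 = 0 -> w = 0.
Proof.
rewrite mxE => /eqP; rewrite psumr_eq0; last first.
  by move=> k _; rewrite mxE -expr2 sqr_ge0.
move=> /allP w0; apply/rowP => k; have /implyP/(_ isT) := w0 k (mem_index_enum _).
by rewrite !mxE -expr2 sqrf_eq0 => /eqP.
Qed.

(** A finite form of the identity principle for analytic functions: all derivatives $vA^ke^{tA}B$
    vanish at [t0], and the finite expansion of $e^{(t-t0)A}$ recovers the value at any [t]. *)
Lemma nilpotent_expmx_eq0_near (R : realType) (n m q : nat) (A : 'M[R]_n)
    (B : 'M[R]_(n, m)) (v : 'rV[R]_n) (t0 : R) : A ^+ q = 0 ->
  (\forall t \near t0, v *m expmx (t *: A) *m B = 0) ->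
  forall t, v *m expmx (t *: A) *m B = 0.
Proof.
move=> Aq vB0 t.
have vAkB0 (k : nat) : \forall t \near t0, v *m A ^+ k *m expmx (t *: A) *m B = 0.
  elim: k => [|k ih]; first by rewrite expr0 mulmx1.
  (* [near_join] upgrades vanishing near [t0] to vanishing on a neighbourhood of each nearby [s],
     which is what differentiating at [s] requires. *)
  apply: filterS (near_join ih) => s sB0.
  have d1 : is_derive s (1 : R) (fun t => v *m A ^+ k *m expmx (t *: A) *m B)
      (v *m A ^+ k.+1 *m expmx (s *: A) *m B).
    have := is_derive_mulmxr B (is_derive_mulmxl (v *m A ^+ k)
      (is_derive_nilpotent_expmx Aq s)).
    by rewrite exprSr -mulmxE !mulmxA.
  have d2 : is_derive s (1 : R) (fun t => v *m A ^+ k *m expmx (t *: A) *m B) 0.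
    apply: (@near_eq_is_derive _ _ _ (cst 0)).
    by apply: filterS sB0 => r ->.
  by rewrite -(@derive_val _ _ _ _ _ _ _ d1) (@derive_val _ _ _ _ _ _ _ d2).
have -> : t = (t - t0) + t0 by rewrite subrK.
rewrite (nilpotent_expmxD Aq) (@nilpotent_expmxE _ _ q); last first.
  by rewrite exprZmx Aq scaler0.
rewrite mulmx_suml mulmx_sumr mulmx_suml big1// => k _.
rewrite exprZmx -!scalemxAl -!scalemxAr -!scalemxAl mulmxA.
by rewrite (nbhs_singleton (vAkB0 k)) !scaler0.
Qed.

(** Steer $v^T$ to 0. Since the input is invisible to $ve^{-tA}B$, the quantity $ve^{-tA}x(t)$ is
    constant along the trajectory; it equals $vv^T$ at the start and 0 at the end. *)
Lemma controllable_expmx_eq0 (R : realType) (n m q : nat) (A : 'M[R]_n)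
    (B : 'M[R]_(n, m)) (v : 'rV[R]_n) : A ^+ q = 0 -> controllable A B ->
  (forall t, v *m expmx (t *: A) *m B = 0) -> v = 0.
Proof.
move=> Aq /(_ v^T 0)[T [u [x [T0 _ xT dx [x0 xT0]]]]] vB0.
pose p t := v *m expmx ((0 - t) *: A) *m x t.
have : p T = p 0.
  apply: is_derive0_eq; first exact: ltW.
  - apply: within_continuous_mulmx => [i k|k j].
      apply: derivable_within_continuous => r _.
      have := is_derive_mulmxl v (is_derive_nilpotent_expmxN Aq 0 r).
      by move=> /is_derive_mxP/(_ i k)/@ex_derive.
    exact: within_continuous_coord (derivable_oo_LRcontinuous_within xT) k j.
  - move=> t; rewrite in_itv => /dx xt.
    have := is_derive_mulmx (is_derive_mulmxl v (is_derive_nilpotent_expmxN Aq 0 t)) xt.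
    rewrite mulmxDr mulmxN mulNmx !mulmxA vB0 mul0mx addr0.
    by rewrite -(mulmxA v A) (nilpotent_expmx_comm Aq) mulmxA addNr.
rewrite /p xT0 mulmx0 subr0 (nilpotent_expmx0 Aq) mulmx1 x0 => v0.
by apply: mul_rV_tr_eq0; rewrite -v0 mxE.
Qed.

Definition gramian_integrand (R : realType) (n m : nat) (A : 'M[R]_n)
    (B : 'M[R]_(n, m)) (S : R -> R) (s : R) : 'M[R]_n :=
  S s *: (expmx (- (s *: A)) *m B *m B^T *m expmx (- (s *: A^T))).

(** Provides the Gramian as the final value of a primitive, so that later arguments differentiate
    instead of manipulating integrals. *)
Lemma gramian_primitive (R : realType) (n m q : nat) (A : 'M[R]_n)
    (B : 'M[R]_(n, m)) (h : R) (S : R -> R) :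
  A ^+ q = 0 -> 0 < h -> {within `[2 * h, 3 * h], continuous S} ->
  exists F : R -> 'M[R]_n,
    [/\ F (2 * h) = 0, F (3 * h) = Gramian A B h S,
        forall i j, {within `[2 * h, 3 * h], continuous (fun t => F t i j)}
      & {in `]2 * h, 3 * h[, forall t,
          is_derive t (1 : R) F (gramian_integrand A B S t)}].
Proof.
move=> Aq h0 cS; apply: mx_primitive; first by lra.
move=> i j.
have cE i' j' : {within `[2 * h, 3 * h], continuous (fun s => expmx (- (s *: A)) i' j')}.
  have -> : (fun s => expmx (- (s *: A)) i' j') = (fun s => expmx ((0 - s) *: A) i' j').
    by apply/funext => s; rewrite sub0r scaleNr.
  exact: is_derive_coord_continuous (is_derive_nilpotent_expmxN Aq 0) _ _.
have cB (k l : nat) (C : 'M[R]_(k, l)) i' j' :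
  {within `[2 * h, 3 * h], continuous (fun=> C i' j')} by exact: cst_continuous.
have -> : (fun s => gramian_integrand A B S s i j) = (fun s => S s *
    (expmx (- (s *: A)) *m B *m B^T *m (expmx (- (s *: A)))^T) i j).
  apply/funext => s; rewrite mxE -!scaleNr; congr (_ * (_ *m _) i j).
  by rewrite (trmx_nilpotent_expmx Aq).
move=> s; apply: continuousM; first exact: cS.
move: s; apply: within_continuous_mulmx => i' k; last first.
  have -> : (fun s => (expmx (- (s *: A)))^T i' k) = (fun s => (expmx (- (s *: A))) k i').
    by apply/funext => s; rewrite mxE.
  exact: cE.
by do 2!(apply: within_continuous_mulmx => // {}i' {}k).
Qed.

(** If $vW = 0$, then $G = vFv^T$ has derivative $S\,|ve^{-tA}B|^2 \ge 0$ and vanishes at both ends,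
    hence everywhere. Its derivative is therefore 0, and near [hs], where [S] is positive, this
    forces $ve^{-tA}B = 0$. *)
Lemma Gramian_unitmx (R : realType) (n m q : nat) (A : 'M[R]_n)
    (B : 'M[R]_(n, m)) (h : R) (S : R -> R) :
  A ^+ q = 0 -> controllable A B -> 0 < h ->
  {within `[2 * h, 3 * h], continuous S} ->
  (forall t, 2 * h <= t <= 3 * h -> 0 <= S t) ->
  (exists2 hs, 2 * h < hs < 3 * h & 0 < S hs) ->
  Gramian A B h S \in unitmx.
Proof.
move=> Aq AB h0 cS S0 [hs hsh Shs].
have [F [Fa Fb cF dF]] := gramian_primitive B Aq h0 cS.
rewrite -row_free_unit; apply: inj_row_free => v vW.
pose w t := v *m expmx ((0 - t) *: A) *m B.
pose G t := (v *m F t *m v^T) 0 0.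
have dG t : t \in `]2 * h, 3 * h[ -> is_derive t (1 : R) G (S t * (w t *m (w t)^T) 0 0).
  move=> /dF dFt.
  have /is_derive_mxP/(_ 0 0) := is_derive_mulmxr v^T (is_derive_mulmxl v dFt).
  move/is_derive_eq; apply.
  rewrite /gramian_integrand -scalemxAr -scalemxAl mxE; congr (_ * _ 0 0).
  rewrite /w sub0r -!scaleNr -(trmx_nilpotent_expmx Aq) !trmx_mul.
  by rewrite !mulmxA.
have dG_ge0 t : t \in `]2 * h, 3 * h[ -> 0 <= S t * (w t *m (w t)^T) 0 0.
  rewrite in_itv/= => /andP[/ltW ? /ltW ?].
  by rewrite mulr_ge0 ?mul_rV_tr_ge0// S0//; apply/andP.
have cG : {within `[2 * h, 3 * h], continuous G}.
  apply: within_continuous_mulmx => i j; last exact: cst_continuous.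
  apply: within_continuous_mulmx => // {}i {}j; exact: cst_continuous.
have Ga : G (2 * h) = 0 by rewrite /G Fa mulmx0 mul0mx mxE.
have Gb : G (3 * h) = 0 by rewrite /G Fb vW mul0mx mxE.
have G_mono : {in `[2 * h, 3 * h]%R &, {homo G : x y / x <= y >-> x <= y}}.
  apply: ger0_derive1_le_cc => // t tI.
    by have /@ex_derive := dG t tI.
  by rewrite derive1E; have /@derive_val-> := dG t tI; exact: dG_ge0.
have G0 t : t \in `[2 * h, 3 * h] -> G t = 0.
  move=> tI; have := tI; rewrite in_itv/= => /andP[ta tb].
  have ab : 2 * h <= 3 * h by lra.
  apply/eqP; rewrite eq_le; apply/andP; split; [rewrite -Gb|rewrite -Ga];
    by apply: G_mono; rewrite ?in_itv/= ?ta ?tb ?ab ?lexx.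
have hsI : hs \in `]2 * h, 3 * h[ by rewrite in_itv.
have w0 : \forall t \near hs, w t = 0.
  have tI : \forall t \near hs, t \in `]2 * h, 3 * h[ by exact: near_in_itvoo.
  have St : \forall t \near hs, 0 < S t.
    have /continuous_within_itvP[|cS' _ _] := cS; first by lra.
    exact: (cvgr_gt _ (cS' _ hsI)).
  near=> t.
  have tJ : t \in `]2 * h, 3 * h[ by near: t.
  have SG : S t * (w t *m (w t)^T) 0 0 = 0.
    have dGt := dG t tJ.
    have dGt0 : is_derive t (1 : R) G 0.
      apply: (@near_eq_is_derive _ _ _ (cst 0)).
      near=> s; apply/esym/G0; apply: subset_itv_oo_cc.
      by near: s; exact: near_in_itvoo.
    by rewrite -(@derive_val _ _ _ _ _ _ _ dGt) (@derive_val _ _ _ _ _ _ _ dGt0).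
  apply: mul_rV_tr_eq0; apply/eqP; move/eqP: SG; rewrite mulf_eq0 gt_eqF//.
  by near: t.
apply: (controllable_expmx_eq0 Aq AB).
(* The function [w] carries the exponential of [- t *: A], so vanishing near [hs] becomes vanishing
   near [- hs]. *)
apply: (nilpotent_expmx_eq0_near (t0 := - hs) Aq).
have cN : - t @[t --> - hs] --> hs by rewrite -{2}(opprK hs); exact: cvgN.
have : \forall t \near - hs, w (- t) = 0 by have := cN _ w0.
by apply: filterS => t; rewrite /w sub0r opprK.
Unshelve. all: by end_near. Qed.

(** * Variation of constants *)

Lemma is_derive_variation (R : realType) (n q : nat) (A : 'M[R]_n) (a t : R)
    (x : R -> 'cV[R]_n) (f : 'cV[R]_n) : A ^+ q = 0 ->
  is_derive t (1 : R) x (A *m x t + f) ->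
  is_derive t (1 : R) (fun s => expmx ((a - s) *: A) *m x s)
    (expmx ((a - t) *: A) *m f).
Proof.
move=> Aq dx; have := is_derive_mulmx (is_derive_nilpotent_expmxN Aq a t) dx.
move/is_derive_eq; apply.
by rewrite mulmxDr addrA mulNmx !mulmxA (nilpotent_expmx_comm Aq) addNr add0r.
Qed.

Lemma linear_flow (R : realType) (n q : nat) (A : 'M[R]_n) (a b : R)
    (x : R -> 'cV[R]_n) : A ^+ q = 0 -> a <= b ->
  {within `[a, b], continuous x} ->
  {in `]a, b[, forall t, is_derive t (1 : R) x (A *m x t)} ->
  x b = expmx ((b - a) *: A) *m x a.
Proof.
move=> Aq ab cx dx; pose p t := expmx ((a - t) *: A) *m x t.
have p_eq : p b = p a.
  apply: is_derive0_eq ab _ _.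
  - apply: within_continuous_mulmx; last exact: within_continuous_coord.
    exact: is_derive_coord_continuous (is_derive_nilpotent_expmxN Aq a).
  - move=> t /dx; rewrite -[A *m x t]addr0 => dxt.
    by have := is_derive_variation a Aq dxt; rewrite mulmx0.
move: p_eq; rewrite /p subrr (nilpotent_expmx0 Aq) mul1mx => <-.
rewrite mulmxA -(nilpotent_expmxD Aq) addrA subrK subrr.
by rewrite (nilpotent_expmx0 Aq) mul1mx.
Qed.

(** * The switching function and the indexing of periods *)

Lemma switch_eq0 (R : realType) (h : R) (l : nat) (t : R) : 0 < h ->
  3 * l%:R * h <= t <= 3 * l%:R * h + 2 * h -> switch h t = 0.
Proof.
move=> h0 /andP[lt tl]; rewrite /switch indicE memNset// => -[l' _] /=.
rewrite in_itv/= => /andP[l't tl'].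
(* If [t] lay in the window of index [l'], its left end would give [l' < l]. Then [l' + 1 <= l] puts
   the right end of that window at or before the start of period [l], a contradiction. *)
have : l'%:R < l%:R :> R by rewrite -(ltr_pM2r h0); lra.
rewrite ltr_nat -(@ler_nat R) -natr1 -(ler_pM2r h0); lra.
Qed.

Lemma switch_eq1 (R : realType) (h : R) (l : nat) (t : R) :
  3 * l%:R * h + 2 * h < t < 3 * l%:R * h + 3 * h -> switch h t = 1.
Proof.
move=> /andP[lt tl]; rewrite /switch indicE mem_set//; exists l => //=.
rewrite in_itv/=; apply/andP; split; lra.
Qed.

Lemma floor_period (R : realType) (h : R) (l : nat) (t : R) : 0 < h ->
  3 * l%:R * h <= t < 3 * l%:R * h + 3 * h -> Num.floor (t / (3 * h)) = l.
Proof.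
move=> h0 /andP[lt tl]; have h3 : 0 < 3 * h by lra.
apply: floor_def; rewrite ler_pdivlMr// ltr_pdivrMr// intrD mulr1z -pmulrn.
by apply/andP; split; lra.
Qed.

Lemma periodic_nat (R : realType) (V : Type) (f : R -> V) (p : R) : 0 <= p ->
  (forall t, 0 <= t -> f (t + p) = f t) ->
  forall (l : nat) t, 0 <= t -> f (t + l%:R * p) = f t.
Proof.
move=> p0 fp; elim=> [|l ih] t t0; first by rewrite mul0r addr0.
rewrite -natr1 mulrDl mul1r addrA fp ?ih//.
by rewrite addr_ge0// mulr_ge0.
Qed.

(** * The closed loop over one period, starting at time [a] *)

Section period.
Context {R : realType} {n m q : nat} {A : 'M[R]_n} {B : 'M[R]_(n, m)}.
Context {tau h : R} {S : R -> R} {x0 : 'cV[R]_n}.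
Context {x : R -> 'cV[R]_n} {u : R -> 'cV[R]_m}.
Hypotheses (Aq : A ^+ q = 0) (AB : controllable A B).
Hypotheses (h0 : 0 < h) (tau_h : 0 <= tau <= h).
Hypotheses (S_adm : admissible_weight h S).
Hypotheses (sol : closed_loop_solution A B tau h S x0 x u).

Let dx (t : R) : 0 < t -> is_derive t (1 : R) x (A *m x t + B *m u t).
Proof. by case: sol => _ _ + _; apply. Qed.

Let cx (a b : R) : 0 <= a -> {within `[a, b], continuous x}.
Proof.
move=> a0; apply: continuous_subspaceW (derivable_oy_Rcontinuous_within_itvcy _).
  (* At time 0 only continuity from the right is given, so continuity is obtained on the half-line
     from 0 and then restricted. *)
  by apply: (@subset_trans _ `[0, b]); [exact: subset_itvr|exact: subset_itvl].
split; last by case: sol.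
by move=> t; rewrite in_itv/= andbT => /dx/@ex_derive.
Qed.

Let cS : {within `[2 * h, 3 * h], continuous S}.
Proof.
case: S_adm => -[[dS _] _ _ _] _ _ _ _.
apply: derivable_within_continuous => t; rewrite in_itv/= => /andP[ht _].
by apply: dS; rewrite in_itv/= andbT (lt_le_trans _ ht)// mulr_gt0.
Qed.

Variable l : nat.
Let a : R := 3 * l%:R * h.

Let a0 : 0 <= a.
Proof. by rewrite /a !mulr_ge0// ltW. Qed.

(** Both endpoints are included because the windows of [switch] are open. *)
Let u_free (t : R) : a <= t <= a + 2 * h -> u t = 0.
Proof.
move=> tI; have /andP[at_ _] := tI.
case: sol => _ _ _ ->; last exact: le_trans at_.
by rewrite (switch_eq0 h0 tI) mulr0 scale0r oppr0.
Qed.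

Let x_free (t : R) : a <= t <= a + 2 * h -> x t = expmx ((t - a) *: A) *m x a.
Proof.
move=> /andP[at_ ta]; apply: (linear_flow Aq at_ (cx a0)) => s.
rewrite in_itv/= => /andP[as_ st].
have s0 : 0 < s by exact: le_lt_trans as_.
have := dx s0; rewrite u_free ?mulmx0 ?addr0//.
by rewrite (ltW as_)/= (le_trans (ltW st)).
Qed.

(** As [0 <= tau <= h], the time [t - h - tau] lies in the free phase of the same period, so the
    output read is a free motion from [x a]. The exponential in the gain cancels all of its exponent
    except [- tau]: the unknown delay survives only as a constant factor. *)
Let u_control (t : R) : a + 2 * h < t < a + 3 * h ->
  u t = - (S (t - a) *: (B^T *m expmx (- ((t - a) *: A^T)) *m
            invmx (Gramian A B h S) *m (expmx (- tau *: A) *m x a))).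
Proof.
move=> tI; have /andP[at_ ta] := tI; have a_ge0 := a0.
have /andP[tau0 tauh] := tau_h.
case: sol => _ _ _ ->; last by lra.
rewrite (switch_eq1 tI) mulr1 /delayed_output ifF; last first.
  by apply/negbTE; rewrite -ltNge; lra.
have -> : S t = S (t - a).
  case: S_adm => -[_ _ _ perS] _ _ _ _.
  have {1}<- : t - a + l%:R * (3 * h) = t by rewrite /a; ring.
  by apply: periodic_nat => //; lra.
rewrite x_free; last by apply/andP; split; lra.
have fl : Num.floor (t / (3 * h)) = l.
  by apply: floor_period h0 _; rewrite -/a; apply/andP; split; lra.
rewrite /gain fl.
rewrite -[l%:~R]/(l%:R) -/a -!mulmxA; congr (- (_ *: (_ *m (_ *m (_ *m _))))).
rewrite -scaleNr mulmxA -(nilpotent_expmxD Aq).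
by have -> : - (t - a - h) + (t - h - tau - a) = - tau by ring.
Qed.

Lemma period_map :
  x (a + 3 * h) = expmx (3 * h *: A) *m (1%:M - expmx (- tau *: A)) *m x a.
Proof.
have h_gt0 := h0.
have [F [Fa Fb cF dF]] := gramian_primitive B Aq h0 cS.
have W_unit : Gramian A B h S \in unitmx.
  by case: S_adm => _ S0 S_hs _ _; exact: Gramian_unitmx Aq AB h0 cS S0 S_hs.
pose c := invmx (Gramian A B h S) *m (expmx (- tau *: A) *m x a).
(* In the variation of constants the input contributes $-F'(s)c$, with [F] the primitive of the
   Gramian integrand; adding $F(s)c$ gives a conserved quantity on [[2h, 3h]]. *)
pose p s := expmx ((0 - s) *: A) *m x (s + a) + F s *m c.
have dz (s : R) : 0 < s ->
    is_derive s (1 : R) (fun s => x (s + a)) (A *m x (s + a) + B *m u (s + a)).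
  by move=> s0; apply: is_derive_translate; apply: dx; rewrite ltr_wpDr.
have p_eq : p (3 * h) = p (2 * h).
  apply: is_derive0_eq; first by lra.
  - move=> i j.
    have -> : (fun s => p s i j) =
      (fun s => (expmx ((0 - s) *: A) *m x (s + a)) i j + (F s *m c) i j).
      by apply/funext => s; rewrite mxE.
    move=> s; apply: continuousD; move: s.
      apply: within_continuous_mulmx.
        exact: is_derive_coord_continuous (is_derive_nilpotent_expmxN Aq 0).
      move=> k {}j; apply: derivable_within_continuous => s.
      rewrite in_itv/= => /andP[hs _].
      have /dz/is_derive_mxP/(_ k j)/@ex_derive// : 0 < s by lra.
    by apply: within_continuous_mulmx => // {}i {}j; exact: cst_continuous.
  - move=> s sI; have := sI; rewrite in_itv/= => /andP[hs sh].
    have s0 : 0 < s by lra.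
    have := is_deriveD (is_derive_variation 0 Aq (dz _ s0))
      (is_derive_mulmxr c (dF _ sI)).
    move/is_derive_eq; apply.
    rewrite u_control; last by apply/andP; split; lra.
    rewrite addrK /gramian_integrand sub0r scaleNr !mulmxN -!scalemxAr -scalemxAl.
    by rewrite /c !mulmxA addNr.
(* At [3 * h] the Gramian cancels its inverse, and at [2 * h] the free motion brings back [x a].
   What is left is $e^{-3hA}x(a+3h) + e^{-\tau A}x(a) = x(a)$, to be solved for $x(a+3h)$. *)
have := p_eq; rewrite /p Fa Fb mul0mx addr0 !sub0r /c mulmxA mulmxV// mul1mx.
have -> : x (2 * h + a) = expmx (2 * h *: A) *m x a.
  by rewrite x_free ?addrK//; apply/andP; split; lra.
rewrite mulmxA (nilpotent_expmxN Aq) mul1mx.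
move=> /(congr1 (fun M => M - expmx (- tau *: A) *m x a)); rewrite addrK.
move=> /(congr1 (mulmx (expmx (3 * h *: A)))).
rewrite mulmxA -(nilpotent_expmxD Aq) subrr (nilpotent_expmx0 Aq) mul1mx.
by rewrite addrC => ->; rewrite -mulmxA mulmxBl mul1mx.
Qed.

(** The input vanishes in the first phase by the switch and in the second because it is linear in
    [x a]; the state then follows the free flow from 0. The right end is left to the next period. *)
Lemma period_eq0 : x a = 0 ->
  forall t, a <= t < a + 3 * h -> x t = 0 /\ u t = 0.
Proof.
move=> xa0.
have u0 t : a <= t < a + 3 * h -> u t = 0.
  move=> /andP[at_ ta]; have [th|ht] := leP t (a + 2 * h).
    by apply: u_free; rewrite at_.
  by rewrite u_control ?ht// xa0 !mulmx0 scaler0 oppr0.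
move=> t tI; split; last exact: u0.
have /andP[at_ ta] := tI.
rewrite (linear_flow Aq at_ (cx a0)) ?xa0 ?mulmx0// => s.
rewrite in_itv/= => /andP[as_ st].
have := dx (le_lt_trans a0 as_); rewrite u0 ?mulmx0 ?addr0//.
by rewrite (ltW as_)/= (lt_trans st).
Qed.

End period.

(** * Iteration of the period map *)

Theorem theorem1 (R : realType) (n m q : nat)
    (A : 'M[R]_n) (B0 : 'M[R]_(n, m)) (tauM tau0 h : R) (S : R -> R)
    (q_le_n : (q <= n)%N) (Aq : A ^+ q = 0) (Aq1 : A ^+ q.-1 != 0)
    (ctrl : controllable A B0)
    (tauM_gt0 : 0 < tauM) (tau0_itv : 0 <= tau0 <= tauM) (h_ge : tauM <= h)
    (S_adm : admissible_weight h S)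
    (x0 : 'cV[R]_n) (x : R -> 'cV[R]_n) (u : R -> 'cV[R]_m)
    (sol : closed_loop_solution A B0 tau0 h S x0 x u) :
  forall t : R, 3 * q%:R * h <= t -> x t = 0 /\ u t = 0.
Proof.
have h0 : 0 < h by exact: lt_le_trans h_ge.
have tau_h : 0 <= tau0 <= h.
  by have /andP[-> /le_trans ->] := tau0_itv.
pose T := expmx (3 * h *: A) *m (1%:M - expmx (- tau0 *: A)).
have Tq : T ^+ q = 0.
  have [P AP TE] := nilpotent_expmx_factor Aq (- tau0).
  (* [T] is a product of [A] and a matrix commuting with it, so its [q]-th power contains the factor
     [A ^+ q]. *)
  have -> : T = A * (expmx (3 * h *: A) * P).
    by rewrite /T TE -!mulmxE !mulmxA (nilpotent_expmx_comm Aq).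
  rewrite exprMn_comm ?Aq ?mul0r//.
  by apply: commrM AP; exact: nilpotent_expmx_comm Aq _.
have xE (l : nat) : x (3 * l%:R * h) = T ^+ l *m x 0.
  elim: l => [|l ih]; first by rewrite mulr0 mul0r expr0 mul1mx.
  have -> : 3 * l.+1%:R * h = 3 * l%:R * h + 3 * h by rewrite -natr1; ring.
  by rewrite (period_map Aq ctrl h0 tau_h S_adm sol) ih exprS -mulmxE mulmxA.
move=> t qt.
have t0 : 0 <= t by apply: le_trans qt; rewrite !mulr_ge0// ltW.
have h3 : 0 < 3 * h by lra.
pose l := Num.truncn (t / (3 * h)).
have /andP[lt tl] : l%:R <= t / (3 * h) < l.+1%:R.
  by apply: truncn_itv; rewrite divr_ge0// ltW.
(* The index [l] is that of the period containing [t], so [3qh <= t < 3(l+1)h] gives [q < l + 1]. *)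
have ql : (q <= l)%N.
  rewrite -ltnS -(ltr_nat R); apply: le_lt_trans tl.
  by rewrite ler_pdivlMr//; lra.
apply: (period_eq0 Aq h0 tau_h S_adm sol (l := l)).
  by rewrite xE -(subnK ql) exprD Tq mulr0 mul0mx.
move: lt tl; rewrite ler_pdivlMr// ltr_pdivrMr// -natr1 => lt tl.
by apply/andP; split; lra.
Qed.
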